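(* Let $\mathbf{A}$ be a finite simple non-abelian Mal'cev algebra with idempotents $e_1,\dots,e_n$ in (pairwise) distinct $\operatorname{Aut}\mathbf{A}$-orbits, let $\mathbf{B}$ be a Boolean algebra with Stone space $X$, let $x_1,\dots,x_n\in X$ be distinct, and let $X^\circ := X\setminus\{x_1,\dots,x_n\}$. Write $\mathbf{D} := (\mathbf{A}^{\mathbf{B}})^{x_1,\dots,x_n}_{e_1,\dots,e_n}$. For $\varphi\in\operatorname{Aut}\mathbf{D}$ and $x\in X$ define $\overline{\varphi}(x) := x$ if $x\in\{x_1,\dots,x_n\}$ and $\overline{\varphi}(x) := \varphi^\circ(x)$ otherwise. (1) The mapping $$h\colon \operatorname{Aut}\mathbf{D}\to(\operatorname{Homeo} X)_{\{x_1,\dots,x_n\}},\quad \varphi\mapsto\overline{\varphi},$$ is a group epimorphism, and $$\operatorname{Aut}\mathbf{D}\cong \ker h\rtimes(\operatorname{Homeo} X)_{\{x_1,\dots,x_n\}}.$$ (2) Let $K\subseteq(\operatorname{Aut}\mathbf{A})^{X^\circ}$ be the set of all continuous maps $\psi\colon X^\circ\to\operatorname{Aut}\mathbf{A}$ such that $\psi^{-1}((\operatorname{Aut}\mathbf{A})_{e_i})\cup\{x_i\}$ is open in $X$ for each $i\in\{1,\dots,n\}$. Then $$p\colon\ker h\to K,\quad \varphi\mapsto\varphi_*,$$ is a group isomorphism.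
   Context: An algebra is Mal'cev if it has a ternary term operation $m$ satisfying $m(x,x,y)=y=m(y,x,x)$. A Mal'cev algebra is abelian if its basic operations can be represented as affine functions over a module; otherwise it is non-abelian. An element $e$ of $\mathbf{A}$ is an idempotent if $\{e\}$ is a subalgebra of $\mathbf{A}$. Here $n\geq 0$. The Stone space $X$ of a Boolean algebra $\mathbf{B}$ is its set of ultrafilters with basic open sets $\{x\in X : b\in x\}$, $b\in B$. The Boolean power $\mathbf{A}^{\mathbf{B}}$ is the subalgebra of the direct power $\mathbf{A}^X$ whose elements are the continuous functions $f\colon X\to A$, where $A$ is discrete. The filtered Boolean power $(\mathbf{A}^{\mathbf{B}})^{x_1,\dots,x_n}_{e_1,\dots,e_n}$ is the subalgebra of $\mathbf{A}^{\mathbf{B}}$ with universe $\{f\in A^{\mathbf{B}} : f(x_1)=e_1,\dots,f(x_n)=e_n\}$. $X^\circ$ has the subspace topology and $\operatorname{Aut}\mathbf{A}$ is discrete. $(\operatorname{Homeo} X)_{\{x_1,\dots,x_n\}}$ is the group of homeomorphisms of $X$ fixing each $x_i$, and $(\operatorname{Aut}\mathbf{A})_{e_i}$ is the stabilizer of $e_i$. The group operation on $(\operatorname{Aut}\mathbf{A})^{X^\circ}$ is pointwise. The symbol $\rtimes$ denotes a semidirect product (with respect to a suitable action), with $\ker h$ the normal factor. For $x\in X$ let $\pi_x\colon\mathbf{D}\to\mathbf{A}$, $f\mapsto f(x)$, and $\theta_x:=\ker\pi_x=\{(f,g)\in D^2: f(x)=g(x)\}$. For $\varphi\in\operatorname{Aut}\mathbf{D}$,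 the map $\varphi^\circ\colon X^\circ\to X^\circ$ is the (well-defined) homeomorphism determined by $\varphi(\theta_x)=\theta_{\varphi^\circ(x)}$, where $\varphi(\theta_x):=\{(\varphi(f),\varphi(g)) : (f,g)\in\theta_x\}$. For $x\in X^\circ$, $\varphi_x\in\operatorname{Aut}\mathbf{A}$ is the (well-defined) automorphism determined by $\varphi_x\pi_x=\pi_{\varphi^\circ(x)}\varphi$, i.e. $\varphi_x(f(x))=\varphi(f)(\varphi^\circ(x))$ for all $f\in D$. Finally $\varphi_*\colon X^\circ\to\operatorname{Aut}\mathbf{A}$ is the map $x\mapsto\varphi_x$. *)

(* Defs.v *)
From HB Require Import structures.
From mathcomp Require Import all_boot all_order all_algebra.
From mathcomp Require Import all_classical topology.

Set Implicit Arguments.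
Unset Strict Implicit.
Unset Printing Implicit Defensive.

Import Order.TTheory GRing.Theory.

Local Open Scope classical_set_scope.

Record signature := Signature { operation :> Type; arity : operation -> nat }.

(* Carriers are choice types; classically every type is one. *)
Record algebra (S : signature) := Algebra {
  carrier :> choiceType;
  interp : forall o : S, ('I_(arity o) -> carrier) -> carrier
}.

Inductive term (S : signature) (V : Type) :=
| Var of V
| App (o : S) of 'I_(arity o) -> term S V.

Section Algebras.
Variable S : signature.
Implicit Types A : algebra S.

Fixpoint term_eval A (V : Type) (env : V -> A) (t : term S V) : A :=
  match t with
  | Var v => env v
  | App o ts => interp (fun j : 'I_(arity o) => term_eval env (ts j))
  end.

Definition homomorphism A A' (f : A -> A') :=
  forall (o : S) (a : 'I_(arity o) -> A), f (interp a) = interp (f \o a).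

Definition congruence A (R : A -> A -> Prop) :=
  [/\ forall a, R a a,
      forall a b, R a b -> R b a,
      forall a b c, R a b -> R b c -> R a c &
      forall (o : S) (a b : 'I_(arity o) -> A),
        (forall j, R (a j) (b j)) -> R (interp a) (interp b)].

Definition simple_algebra A :=
  (exists a b : A, a <> b) /\
  forall R : A -> A -> Prop, congruence R ->
    (forall a b, R a b <-> a = b) \/ (forall a b, R a b).

Definition malcev A :=
  exists m : term S 'I_3, forall x y : A,
    term_eval (tnth [tuple x; x; y]) m = y /\ term_eval (tnth [tuple y; x; x]) m = y.

(* [iota] identifies the universe of [A] with that of the module [M]. *)
Definition abelian_algebra A :=
  exists (R : pzRingType) (M : lmodType R) (iota : A -> M),
    bijective iota /\
    forall o : S, exists (r : 'I_(arity o) -> R) (c : M),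
      forall a : 'I_(arity o) -> A,
        iota (interp a) = (\sum_j r j *: iota (a j) + c)%R.

Definition subuniverse A (P : set A) :=
  forall (o : S) (a : 'I_(arity o) -> A), (forall j, P (a j)) -> P (interp a).

Definition idempotent_element A (e : A) := subuniverse [set e].

Section Subalgebra.
Variables (A : algebra S) (P : set A) (closedP : subuniverse P).

Definition subalgebra_interp (o : S) (a : 'I_(arity o) -> P) : P :=
  SigSub (mem_set (closedP (fun j => set_valP (a j)))).

Definition subalgebra : algebra S := Algebra subalgebra_interp.

End Subalgebra.

Definition direct_power A (X : Type) : algebra S :=
  @Algebra S (X -> A : choiceType)
    (fun (o : S) (a : 'I_(arity o) -> X -> A) x => interp (a ^~ x)).

End Algebras.

(* The group of all permutations of a possibly infinite type, under
   composition: [(f * g) t = f (g t)]. *)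
Definition symmetric_group (T : choiceType) : Type :=
  [set f : T -> T | bijective f].

Definition sym_fun (T : choiceType) (f : symmetric_group T) : T -> T := \val f.
Coercion sym_fun : symmetric_group >-> Funclass.

Section SymmetricGroup.
Variable T : choiceType.

HB.instance Definition _ := Choice.on (symmetric_group T).

Lemma sym_bij (f : symmetric_group T) : bijective f.
Proof. exact: (set_valP f). Qed.

Lemma symP (f g : symmetric_group T) : f =1 g -> f = g.
Proof. by move=> fg; apply/val_inj/funext. Qed.

Definition sym_mk (f : T -> T) (bij_f : bijective f) : symmetric_group T :=
  SigSub (mem_set (bij_f : [set f : T -> T | bijective f] f)).

Lemma sym_inv_ex (f : symmetric_group T) :
  {g : symmetric_group T | cancel g f /\ cancel f g}.
Proof.
apply: cid; have [g fK gK] := sym_bij f.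
by exists (sym_mk (Bijective gK fK)).
Qed.

Definition sym_one := sym_mk (inv_bij (fun t : T => erefl t : id (id t) = t)).
Definition sym_inv f := sval (sym_inv_ex f).
Definition sym_mul (f g : symmetric_group T) :=
  sym_mk (bij_comp (sym_bij f) (sym_bij g)).

Lemma sym_mulA : associative sym_mul. Proof. by move=> f g h; apply: symP. Qed.
Lemma sym_mul1g : left_id sym_one sym_mul.
Proof. by move=> f; apply: symP. Qed.
Lemma sym_mulg1 : right_id sym_one sym_mul.
Proof. by move=> f; apply: symP. Qed.
Lemma sym_mulVg : left_inverse sym_one sym_inv sym_mul.
Proof.
by move=> f; apply: symP => t; rewrite /sym_fun /= (svalP (sym_inv_ex f)).2.
Qed.
Lemma sym_mulgV : right_inverse sym_one sym_inv sym_mul.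
Proof.
by move=> f; apply: symP => t; rewrite /sym_fun /= (svalP (sym_inv_ex f)).1.
Qed.

HB.instance Definition _ := isGroup.Build (symmetric_group T)
  sym_mulA sym_mul1g sym_mulg1 sym_mulVg sym_mulgV.

Lemma symM (f g : symmetric_group T) t :
  ((f * g)%g : symmetric_group T) t = f (g t).
Proof. by []. Qed.
Lemma sym1 t : (1%g : symmetric_group T) t = t. Proof. by []. Qed.
Lemma symVK (f : symmetric_group T) : cancel (f^-1%g : symmetric_group T) f.
Proof. by move=> t; rewrite -symM mulgV. Qed.
Lemma symK (f : symmetric_group T) : cancel f (f^-1%g : symmetric_group T).
Proof. by move=> t; rewrite -symM mulVg. Qed.

End SymmetricGroup.

Section Automorphisms.
Variables (S : signature) (A : algebra S).

Definition automorphisms : set (symmetric_group A) :=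
  [set f : symmetric_group A | homomorphism (f : A -> A)].

Definition aut_group : Type := automorphisms.

Definition aut_fun (f : aut_group) : A -> A := sym_fun (\val f).

Lemma Aut_group_closed : group_closed (fun f => f \in automorphisms).
Proof.
split; first by apply/mem_set => o a; rewrite sym1.
move=> f g /set_mem fh /set_mem gh; apply/mem_set => o a.
rewrite /= symM -fh; congr (sym_fun f _); apply: (bij_inj (sym_bij g)).
by rewrite symVK gh; congr interp; apply/funext => j /=; rewrite symVK.
Qed.

HB.instance Definition _ := SubChoice.on aut_group.
HB.instance Definition _ :=
  SubChoice_isSubGroup.Build _ _ aut_group Aut_group_closed.

End Automorphisms.
Coercion aut_fun : aut_group >-> Funclass.

Definition aut_stabilizer (S : signature) (A : algebra S) (a : A) : set (aut_group A) :=
  [set alpha | alpha a = a].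

Section Homeomorphisms.
Variables (X : topologicalType) (n : nat) (x : 'I_n -> X).

Definition homeomorphisms_fixing : set (symmetric_group X) :=
  [set g : symmetric_group X | [/\ continuous (g : X -> X),
               continuous ((g^-1%g : symmetric_group X) : X -> X) & forall i, g (x i) = x i]].

Definition homeo_group : Type := homeomorphisms_fixing.

Definition homeo_fun (g : homeo_group) : X -> X := sym_fun (\val g).

Lemma Homeo_group_closed : group_closed (fun g => g \in homeomorphisms_fixing).
Proof.
have sub_comp (f g : symmetric_group X) :
    continuous f -> continuous g ->
    continuous ((f * g)%g : symmetric_group X).
  by move=> cf cg t; apply: (@continuous_comp _ _ _ g f); [apply: cg|apply: cf].
split; first by apply/mem_set; split=> [t|t|i] //; rewrite ?invg1; apply: cvg_id.
move=> f g /set_mem [cf cf' ff] /set_mem [cg cg' fg]; apply/mem_set; split.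
- exact: sub_comp.
- by rewrite invgF; apply: sub_comp.
- move=> i; rewrite symM -[RHS]ff; congr (sym_fun f _).
  by apply: (bij_inj (sym_bij g)); rewrite symVK fg.
Qed.

HB.instance Definition _ := SubChoice.on homeo_group.
HB.instance Definition _ :=
  SubChoice_isSubGroup.Build _ _ homeo_group Homeo_group_closed.

End Homeomorphisms.
Coercion homeo_fun : homeo_group >-> Funclass.

Section FunctionGroup.
Variables (T : Type) (G : groupType).

Definition function_group : Type := T -> G.

HB.instance Definition _ := Choice.copy function_group (T -> G).

Implicit Types f g h : function_group.
Definition fung_one : function_group := fun=> 1%g.
Definition fung_inv f : function_group := fun t => (f t)^-1%g.
Definition fung_mul f g : function_group := fun t => (f t * g t)%g.

Lemma fung_mulA : associative fung_mul.
Proof. by move=> f g h; apply/funext => t; apply: mulgA. Qed.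
Lemma fung_mul1g : left_id fung_one fung_mul.
Proof. by move=> f; apply/funext => t; apply: mul1g. Qed.
Lemma fung_mulg1 : right_id fung_one fung_mul.
Proof. by move=> f; apply/funext => t; apply: mulg1. Qed.
Lemma fung_mulVg : left_inverse fung_one fung_inv fung_mul.
Proof. by move=> f; apply/funext => t; apply: mulVg. Qed.
Lemma fung_mulgV : right_inverse fung_one fung_inv fung_mul.
Proof. by move=> f; apply/funext => t; apply: mulgV. Qed.

HB.instance Definition _ := isGroup.Build function_group
  fung_mulA fung_mul1g fung_mulg1 fung_mulVg fung_mulgV.

End FunctionGroup.

Section Kernel.
Variables (G H : groupType) (h : {multiplicative G -> H}).

Definition hom_kernel_set : set G := [set g | h g = 1%g].

Definition hom_kernel : Type := hom_kernel_set.

Lemma kernel_group_closed : group_closed (fun g => g \in hom_kernel_set).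
Proof.
have h1 : h 1%g = 1%g by apply: (@mulgI _ (h 1%g)); rewrite -gmulfM !mulg1.
split; first exact/mem_set.
move=> f g /set_mem /= hf /set_mem /= hg; apply/mem_set => /=.
by apply: (@mulIg _ (h g)); rewrite -gmulfM mulgVK hf hg mulg1.
Qed.

HB.instance Definition _ := SubChoice.on hom_kernel.
HB.instance Definition _ :=
  SubChoice_isSubGroup.Build _ _ hom_kernel kernel_group_closed.

End Kernel.

Record group_action (H N : groupType) := GroupAction {
  group_act :> H -> N -> N;
  group_act_morph : forall h, {morph group_act h : u v / (u * v)%g};
  group_act1 : forall u, group_act 1%g u = u;
  group_actM : forall g h u, group_act (g * h)%g u = group_act g (group_act h u)
}.

(* The external semidirect product of [N] (normal) and [H]. *)
Section SemidirectProduct.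
Variables (H N : groupType) (alpha : group_action H N).

Definition semidirect of group_action H N : Type := (N * H)%type.

HB.instance Definition _ := Choice.copy (semidirect alpha) (N * H)%type.

Implicit Types p q : semidirect alpha.
Definition sd_one : semidirect alpha := (1, 1)%g.
Definition sd_mul p q : semidirect alpha := (p.1 * alpha p.2 q.1, p.2 * q.2)%g.
Definition sd_inv p : semidirect alpha := (alpha p.2^-1 p.1^-1, p.2^-1)%g.

Lemma group_act_one h : alpha h 1%g = 1%g.
Proof.
by apply: (@mulgI _ (alpha h 1%g)); rewrite -group_act_morph !mulg1.
Qed.

Lemma sd_mulA : associative sd_mul.
Proof.
move=> [u f] [v g] [w h]; rewrite /sd_mul /=; congr (_, _); last exact: mulgA.
by rewrite group_act_morph group_actM mulgA.
Qed.
Lemma sd_mul1g : left_id sd_one sd_mul.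
Proof. by move=> [u f]; rewrite /sd_mul /= group_act1 !mul1g. Qed.
Lemma sd_mulg1 : right_id sd_one sd_mul.
Proof. by move=> [u f]; rewrite /sd_mul /= group_act_one !mulg1. Qed.
Lemma sd_mulVg : left_inverse sd_one sd_inv sd_mul.
Proof.
move=> [u f]; rewrite /sd_mul /= -group_act_morph !mulVg.
by rewrite group_act_one.
Qed.
Lemma sd_mulgV : right_inverse sd_one sd_inv sd_mul.
Proof.
by move=> [u f]; rewrite /sd_mul /= -group_actM !mulgV group_act1 mulgV.
Qed.

HB.instance Definition _ := isGroup.Build (semidirect alpha)
  sd_mulA sd_mul1g sd_mulg1 sd_mulVg sd_mulgV.

End SemidirectProduct.

Section Stone.
Variables (d : Order.disp_t) (B : ctbDistrLatticeType d).

Definition boolean_filter (F : set B) :=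
  [/\ F \top%O,
      forall a b, F a -> F b -> F (Order.meet a b) &
      forall a b, (a <= b)%O -> F a -> F b].

Definition proper_filter (F : set B) := boolean_filter F /\ ~ F \bot%O.

Definition ultrafilter (F : set B) :=
  proper_filter F /\ forall G, proper_filter G -> F `<=` G -> G = F.

Definition stone : Type := [set F : set B | ultrafilter F].

HB.instance Definition _ := Choice.on stone.

Definition basic_open (b : B) : set stone := [set x | (\val x : set B) b].

Lemma stone_ultra (x : stone) : ultrafilter (\val x).
Proof. exact: (set_valP x). Qed.

Lemma basic_open_cover : \bigcup_(U in range basic_open) U = setT.
Proof.
apply/seteqP; split=> // x _; exists (basic_open \top%O); first by exists \top%O.
by have [[[]]] := stone_ultra x.
Qed.

Lemma basic_open_join (U V : set stone) (x : stone) :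
  range basic_open U -> range basic_open V -> U x -> V x ->
  exists W, [/\ range basic_open W, W x & W `<=` U `&` V].
Proof.
move=> [a _ <-] [b _ <-] xa xb; exists (basic_open (Order.meet a b)); split.
- by exists (Order.meet a b).
- by have [[[_ + _] _] _] := stone_ultra x; apply.
- move=> y yab; have [[[_ _ up] _] _] := stone_ultra y.
  by split; apply: up yab; [apply: leIl|apply: leIr].
Qed.

HB.instance Definition _ :=
  isBaseTopological.Build stone basic_open_cover basic_open_join.

Lemma basic_open_open (b : B) : open (basic_open b).
Proof.
exists [set basic_open b]; first by move=> _ ->; exists b.
by rewrite bigcup_set1.
Qed.

Lemma stone_accessible : accessible_space stone.
Proof.
move=> x y xy.
have [b [xb yb]] : exists b, (\val x : set B) b /\ ~ (\val y : set B) b.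
  apply: contrapT => nb; move/eqP: xy; apply; apply/val_inj.
  have [_ xmax] := stone_ultra x; have [yp _] := stone_ultra y.
  apply/esym/xmax => // b xb; apply: contrapT => yb.
  by apply: nb; exists b.
exists (basic_open b); split; first exact: basic_open_open.
  exact: mem_set.
exact: mem_set.
Qed.

End Stone.

Lemma continuous_discreteP (X : topologicalType) (T : choiceType) (f : X -> T) :
  continuous (f : X -> discrete_topology T) <->
  forall x, nbhs x (f @^-1` [set f x]).
Proof.
by split=> cf x; have := cf x; rewrite /continuous_at discrete_cvg.
Qed.

Section BooleanPower.
Variables (S : signature) (A : algebra S) (d : Order.disp_t).
Variable (B : ctbDistrLatticeType d).

Definition continuous_functions : set (direct_power A (stone B)) :=
  [set f | continuous (f : stone B -> discrete_topology A)].

Lemma continuous_functions_closed : subuniverse continuous_functions.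
Proof.
move=> o a ca; apply/continuous_discreteP => t.
have : nbhs t (fun s => forall j, a j s = a j t).
  apply: (@filter_forall _ _ (fun j s => a j s = a j t) _ (nbhs_filter t)) => j.
  by have /continuous_discreteP := ca j; apply.
by apply: filterS => s ajs /=; congr interp; apply/funext => j.
Qed.

Definition boolean_power : algebra S := subalgebra continuous_functions_closed.

Variables (n : nat) (e : 'I_n -> A) (x : 'I_n -> stone B).
Hypothesis e_idem : forall i, idempotent_element (e i).

Definition filtered_functions : set boolean_power :=
  [set f | forall i, (\val f : stone B -> A) (x i) = e i].

Lemma filtered_functions_closed : subuniverse filtered_functions.
Proof. by move=> o a fa i /=; apply: e_idem => j; apply: fa. Qed.

Definition filtered_boolean_power : algebra S :=
  subalgebra filtered_functions_closed.

Local Notation D := filtered_boolean_power.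

(* The subspace obtained by deleting the points [x i]; as a type it carries
   the library's subspace topology. *)
Definition punctured : set (stone B) := ~` range x.

Definition bp_proj (y : stone B) (f : D) : A := (\val (\val f) : stone B -> A) y.

Definition theta (y : stone B) : set (D * D) :=
  [set p | bp_proj y p.1 = bp_proj y p.2].

Definition image_rel (phi : aut_group D) (R : set (D * D)) : set (D * D) :=
  [set (phi p.1, phi p.2) | p in R].

(* [phi_circ], [phi_at] pick the object determined by the defining condition;
   the default values are used only if no object satisfies it. *)
Definition phi_circ (phi : aut_group D) (z : punctured) : punctured :=
  xget z [set w : punctured | image_rel phi (theta (\val z)) = theta (\val w)].

Definition phi_at (phi : aut_group D) (z : punctured) : aut_group A :=
  xget 1%g [set alpha : aut_group A |
    forall f : D, alpha (bp_proj (\val z) f) = bp_proj (\val (phi_circ phi z)) (phi f)].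

Definition phi_star (phi : aut_group D) : function_group punctured (aut_group A) :=
  phi_at phi.

Definition phi_bar (phi : aut_group D) (y : stone B) : stone B :=
  if insub y is Some z then \val (phi_circ phi z) else y.

(* The preimage of the stabilizer lives in [punctured]; its image under [\val]
   moves it to the Stone space, where openness is required. *)
Definition K_set : set (function_group punctured (aut_group A)) :=
  [set psi : punctured -> aut_group A |
    continuous (psi : punctured -> discrete_topology (aut_group A)) /\
    forall i, open ([set \val z | z in psi @^-1` aut_stabilizer (e i)]
                    `|` [set x i])].

Definition K_group : Type := K_set.

Lemma punctured_open : open punctured.
Proof.
rewrite openC; have [+ _] := @accessible_finite_set_closed (stone B).
by apply; [apply: stone_accessible|apply: finite_image].
Qed.

Lemma K_setP (psi : punctured -> aut_group A) :
  K_set psi <->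
  (forall z, nbhs z (psi @^-1` [set psi z])) /\
  forall i, nbhs (x i) (fun y =>
    y = x i \/ exists2 z : punctured, \val z = y & psi z (e i) = e i).
Proof.
split=> [[/continuous_discreteP cpsi opsi]|[cpsi npsi]].
  split=> // i; have /= := open_nbhs_nbhs (conj (opsi i) (or_intror erefl)).
  by apply: filterS => y [[z sz <-]|->]; [right; exists z|left].
split; first exact/continuous_discreteP.
move=> i; rewrite openE => y [[z sz <-]|->]; last first.
  by apply: filterS (npsi i) => w [->|[z <- sz]]; [right|left; exists z].
have [U [[V oV <-] Vz VU]] := cpsi z.
apply: (@filterS _ _ _ (V `&` punctured)); last first.
  apply: open_nbhs_nbhs; split; first exact: openI punctured_open.
  by split => //; apply: set_valP.
move=> w [Vw Xw]; left; exists (SigSub (mem_set Xw)) => //.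
by rewrite /preimage /= (VU (SigSub (mem_set Xw))).
Qed.

Lemma K_group_closed : group_closed (fun psi => psi \in K_set).
Proof.
split.
  apply/mem_set/K_setP; split=> [z|i]; first exact: filterS filterT.
  apply: (@filterS _ _ _ (~` (range x `\ x i))).
    move=> y /= ny; have [->|yi] := eqVneq y (x i); [by left|right].
    suff Xy : punctured y by exists (SigSub (mem_set Xy)).
    by move=> rxy; apply: ny; split=> //; move/eqP: yi.
  apply: open_nbhs_nbhs; split; last by move=> [_ /(_ erefl)].
  rewrite openC; have [+ _] := @accessible_finite_set_closed (stone B).
  by apply; [apply: stone_accessible|apply/finite_setD/finite_image].
move=> f g /set_mem /K_setP [cf nf] /set_mem /K_setP [cg ng].
have fgE z : (f / g)%g z = (f z / g z)%g by [].
apply/mem_set/K_setP; split=> [z|i].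
  by apply: filterS2 (cf z) (cg z) => w fw gw; rewrite /preimage /= !fgE fw gw.
apply: filterS2 (nf i) (ng i) => y [->|[z <- fz]]; first by left.
case=> [->|[w /val_inj -> gz]]; first by left.
right; exists z => //; rewrite fgE.
have gVz : ((g z)^-1%g : aut_group A) (e i) = e i.
  by rewrite -[in LHS]gz; apply: (symK (\val (g z))).
by rewrite -[RHS]fz -[in RHS]gVz.
Qed.

HB.instance Definition _ := SubChoice.on K_group.
HB.instance Definition _ :=
  SubChoice_isSubGroup.Build _ _ K_group K_group_closed.

End BooleanPower.

(* Main.v *)
(* Every homomorphism rho of D onto A is an automorphism of A composed with
   evaluation at a point of the punctured space. For a clopen b, the congruence
   "f = g on b" either lies below ker rho or has full image under rho, since A
   is simple. If this image is full for both b and its complement, then the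
   Mal'cev operation commutes with all term operations of A, and A is affine.
   Otherwise the b whose congruence lies below ker rho form an ultrafilter, which
   is the required point.
   Applied to rho = pi_z \o phi^-1 this yields phi_circ and phi_at. Preimages
   under phi_bar of clopen sets avoiding the x_i are the sets where two elements
   of D differ, which gives continuity away from the x_i. Near x_i an element of
   D has value e_i, so by the orbit condition phi_bar stays away from the other
   x_j. Precomposition with homeomorphisms splits h, and an element of ker h acts
   on each coordinate z by its own automorphism phi_at z. *)

From HB Require Import structures.
Require Import Defs.
From mathcomp Require Import all_boot all_order all_algebra.
From mathcomp Require Import all_classical topology.

Set Implicit Arguments.
Unset Strict Implicit.
Unset Printing Implicit Defensive.

Import Order.TTheory GRing.Theory.

Local Open Scope classical_set_scope.

(** * Affine algebras *)

Section EndomorphismRing.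
Variable V : zmodType.
Local Open Scope ring_scope.

(** With pointwise sum and composition these are the scalars of the module to be built, so that
    every additive self-map can serve as a coefficient. *)
Definition endo : Type := [set f : V -> V | forall u v, f (u + v) = f u + f v].

HB.instance Definition _ := Choice.on endo.

Implicit Types f g h : endo.

Lemma endoP f g : (\val f : V -> V) =1 \val g -> f = g.
Proof. by move=> fg; apply/val_inj/funext. Qed.

Lemma endoD f u v : (\val f : V -> V) (u + v) = (\val f : V -> V) u + (\val f : V -> V) v.
Proof. exact: (set_valP f). Qed.

Definition endo_mk (f : V -> V) (fD : forall u v, f (u + v) = f u + f v) : endo :=
  SigSub (mem_set (fD : [set f : V -> V | forall u v, f (u + v) = f u + f v] f)).

Definition endo0 := endo_mk (fun u v => esym (addr0 (0 : V)) : (fun=> 0) (u + v) = _).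
Definition endo1 := endo_mk (fun u v => erefl : id (u + v) = id u + id v).

Lemma endo_add_subproof f g u v :
  (\val f : V -> V) (u + v) + (\val g : V -> V) (u + v) =
  ((\val f : V -> V) u + (\val g : V -> V) u) +
  ((\val f : V -> V) v + (\val g : V -> V) v).
Proof. by rewrite !endoD addrACA. Qed.

Lemma endo_opp_subproof f u v :
  - (\val f : V -> V) (u + v) = - (\val f : V -> V) u + - (\val f : V -> V) v.
Proof. by rewrite endoD opprD. Qed.

Lemma endo_mul_subproof f g u v :
  (\val f : V -> V) ((\val g : V -> V) (u + v)) =
  (\val f : V -> V) ((\val g : V -> V) u) + (\val f : V -> V) ((\val g : V -> V) v).
Proof. by rewrite !endoD. Qed.

Definition endo_add f g := endo_mk (endo_add_subproof f g).
Definition endo_opp f := endo_mk (endo_opp_subproof f).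
Definition endo_mul f g := endo_mk (endo_mul_subproof f g).

Fact endo_addA : associative endo_add.
Proof. by move=> f g h; apply: endoP => v; apply: addrA. Qed.
Fact endo_addC : commutative endo_add.
Proof. by move=> f g; apply: endoP => v; apply: addrC. Qed.
Fact endo_add0 : left_id endo0 endo_add.
Proof. by move=> f; apply: endoP => v; apply: add0r. Qed.
Fact endo_addN : left_inverse endo0 endo_opp endo_add.
Proof. by move=> f; apply: endoP => v; apply: addNr. Qed.

HB.instance Definition _ :=
  GRing.isZmodule.Build endo endo_addA endo_addC endo_add0 endo_addN.

Fact endo_mulA : associative endo_mul.
Proof. by move=> f g h; apply: endoP. Qed.
Fact endo_mul1r : left_id endo1 endo_mul.
Proof. by move=> f; apply: endoP. Qed.
Fact endo_mulr1 : right_id endo1 endo_mul.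
Proof. by move=> f; apply: endoP. Qed.
Fact endo_mulDl : left_distributive endo_mul endo_add.
Proof. by move=> f g h; apply: endoP. Qed.
Fact endo_mulDr : right_distributive endo_mul endo_add.
Proof. by move=> f g h; apply: endoP => v; apply: endoD. Qed.

HB.instance Definition _ := GRing.Zmodule_isPzRing.Build endo
  endo_mulA endo_mul1r endo_mulr1 endo_mulDl endo_mulDr.

(** A separate name for [V], to carry the module structure over [endo]. *)
Definition endo_module : Type := V.
HB.instance Definition _ := GRing.Zmodule.on endo_module.

Definition endo_scale f (v : endo_module) : endo_module := (\val f : V -> V) v.

Fact endo_scaleA f g v : endo_scale f (endo_scale g v) = endo_scale (f * g) v.
Proof. by []. Qed.
Fact endo_scale1 : left_id 1 endo_scale.
Proof. by []. Qed.
Fact endo_scaleDr : right_distributive endo_scale +%R.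
Proof. by move=> f u v; apply: endoD. Qed.
Fact endo_scaleDl v : {morph endo_scale^~ v : f g / f + g}.
Proof. by []. Qed.

HB.instance Definition _ := GRing.Zmodule_isLmodule.Build endo endo_module
  endo_scaleA endo_scale1 endo_scaleDr endo_scaleDl.

End EndomorphismRing.

(** * The abelian group of a Mal'cev operation commuting with itself *)

Section AffineMalcev.
Variables (T : choiceType) (m : T -> T -> T -> T) (o : T).
Hypothesis mxxy : forall a b, m a a b = b.
Hypothesis mxyy : forall a b, m a b b = a.
Hypothesis mm : forall a1 a2 a3 b1 b2 b3 c1 c2 c3,
  m (m a1 a2 a3) (m b1 b2 b3) (m c1 c2 c3) =
  m (m a1 b1 c1) (m a2 b2 c2) (m a3 b3 c3).

(* The arguments only serve to recover the group operations from the type. *)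
Definition malcev_group of (forall a b, m a a b = b) & (forall a b, m a b b = a)
  & (forall a1 a2 a3 b1 b2 b3 c1 c2 c3,
  m (m a1 a2 a3) (m b1 b2 b3) (m c1 c2 c3) =
  m (m a1 b1 c1) (m a2 b2 c2) (m a3 b3 c3)) & T : Type := T.

Local Notation G := (malcev_group mxxy mxyy mm o).

HB.instance Definition _ := Choice.copy G T.

Definition malcev_add (a b : G) : G := m a o b.
Definition malcev_opp (a : G) : G := m o a o.

(** Associativity, commutativity and inverses are each an instance of the interchange law [mm] on a
    3 by 3 array padded with [o], whose rows and columns collapse by the Mal'cev identities. *)
Fact malcev_addA : associative malcev_add.
Proof.
by move=> a b c; have := mm a o b o o o o o c; rewrite !(mxxy, mxyy) => /esym.
Qed.
Fact malcev_addC : commutative malcev_add.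
Proof.
by move=> a b; have := mm o o a o o o b o o; rewrite !(mxxy, mxyy).
Qed.
Fact malcev_add0 : left_id (o : G) malcev_add.
Proof. by move=> a; apply: mxxy. Qed.
Fact malcev_addN : left_inverse (o : G) malcev_opp malcev_add.
Proof.
by move=> a; have := mm o a o o o o o o a; rewrite !(mxxy, mxyy).
Qed.

HB.instance Definition _ := GRing.isZmodule.Build G
  malcev_addA malcev_addC malcev_add0 malcev_addN.

(** Two padded arrays give [a - b = m a b o] and then [m (m a b o) o c = m a b c]. *)
Lemma malcev_subE (a b c : G) : (a - b + c)%R = m a b c :> G.
Proof.
have := mm a o o o o o o b o; rewrite !(mxxy, mxyy) => eab.
have := mm a b o o o o o o c; rewrite !(mxxy, mxyy) => <-.
by rewrite -eab.
Qed.

End AffineMalcev.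

Definition eval3 S (A : algebra S) (m : term S 'I_3) (a b c : A) : A :=
  term_eval (tnth [tuple a; b; c]) m.

(* The module is [A] with [a + b := m a o b], over its ring of endomorphisms. *)
Lemma commuting_malcev_abelian (S : signature) (A : algebra S)
    (m : A -> A -> A -> A) (o : A) :
  (forall a b, m a a b = b) -> (forall a b, m a b b = a) ->
  (forall a1 a2 a3 b1 b2 b3 c1 c2 c3,
    m (m a1 a2 a3) (m b1 b2 b3) (m c1 c2 c3) =
    m (m a1 b1 c1) (m a2 b2 c2) (m a3 b3 c3)) ->
  (forall (f : S) (a b c : 'I_(arity f) -> A),
    interp (fun j => m (a j) (b j) (c j)) = m (interp a) (interp b) (interp c)) ->
  abelian_algebra A.
Proof.
move=> mxxy mxyy mm mf; pose G := malcev_group mxxy mxyy mm o.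
exists (endo G), (endo_module G), id; split; first by exists id.
move=> f.
(* As [f] commutes with [m], subtracting its value [c] at the constant argument [o] leaves an
   additive map [g]. Its restrictions to single coordinates, by way of [at_], are the
   coefficients. *)
pose at_ (j : 'I_(arity f)) (a : A) := fun i => if i == j then a else o.
pose c : G := interp (fun _ : 'I_(arity f) => o).
pose g := fun a : 'I_(arity f) -> A => ((interp a : G) - c)%R.
have gD (a b : 'I_(arity f) -> A) : g (fun j => m (a j) o (b j)) = (g a + g b)%R.
  by rewrite /g mf -(@malcev_subE _ m o mxxy mxyy mm) -!addrA.
have at_D j a b : at_ j (m a o b) = fun i => m (at_ j a i) o (at_ j b i).
  by apply/funext => i; rewrite /at_; case: eqP => // _; rewrite mxxy.
have rD j (a b : G) : (g (at_ j (a + b)) = g (at_ j a) + g (at_ j b))%R.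
  by rewrite -gD -at_D.
exists (fun j => endo_mk (rD j)), c => a.
have gE : interp a = (g a + c)%R :> G by rewrite subrK.
rewrite [LHS]gE; congr (_ + _)%R.
(* Restoring the coordinates of [a] one at a time splits [g a] into the sum of its values on single
   coordinates. *)
pose part (s : seq 'I_(arity f)) := fun i => if i \in s then a i else o.
have gpart s : uniq s -> g (part s) = (\sum_(j <- s) (g (at_ j (a j)) : G))%R.
  elim: s => [_|j s IH /= /andP[js us]]; first by rewrite big_nil; apply: subrr.
  rewrite big_cons -IH // -gD; congr g; apply/funext => i.
  rewrite /part /at_ inE; have [->|_] /= := eqVneq i j; last by rewrite mxxy.
  by rewrite (negbTE js) mxyy.
rewrite -big_enum /= -[RHS](gpart (enum 'I_(arity f))) ?enum_uniq //.
by congr g; apply/funext => i; rewrite /part mem_enum.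
Qed.

Lemma inj_surj_bijective (T U : Type) (f : T -> U) :
  injective f -> (forall u, exists t, f t = u) -> bijective f.
Proof.
move=> f_inj /choice[g gK]; exists g => // t.
by apply: f_inj; rewrite gK.
Qed.

(** * Terms, compatible relations and automorphisms of an algebra *)

Section Algebras.
Variable S : signature.

Lemma homomorphism_term (A A' : algebra S) (f : A -> A') (V : Type) (env : V -> A)
    (t : term S V) :
  homomorphism f -> f (term_eval env t) = term_eval (f \o env) t.
Proof.
move=> fh; elim: t => //= o ts IH; rewrite fh; congr interp.
by apply/funext => j; apply: IH.
Qed.

Lemma homomorphism_eval3 (A A' : algebra S) (f : A -> A') m a b c :
  homomorphism f -> f (eval3 m a b c) = eval3 m (f a) (f b) (f c).
Proof.
move=> /homomorphism_term ->; rewrite /eval3; congr term_eval.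
by apply/funext => -[[|[|[|]]]].
Qed.

Lemma eval3_compatible (A : algebra S) (R : A -> A -> Prop) m a b c a' b' c' :
  (forall (o : S) (u v : 'I_(arity o) -> A),
    (forall j, R (u j) (v j)) -> R (interp u) (interp v)) ->
  R a a' -> R b b' -> R c c' -> R (eval3 m a b c) (eval3 m a' b' c').
Proof.
move=> Rop Ra Rb Rc; rewrite /eval3.
elim: m => [[[|[|[|]]]]|o ts IH] //=; exact: Rop.
Qed.

(** Applying [m] to the related pairs [(a, a)], [(a, b)], [(b, b)] gives symmetry, and to [(a, b)],
    [(b, b)], [(b, c)] transitivity. *)
Lemma malcev_congruence (A : algebra S) (R : A -> A -> Prop) :
  malcev A -> (forall a, R a a) ->
  (forall (o : S) (u v : 'I_(arity o) -> A),
    (forall j, R (u j) (v j)) -> R (interp u) (interp v)) ->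
  congruence R.
Proof.
move=> [m mP] Rr Rop; split=> // [a b Rab|a b c Rab Rbc].
  have := eval3_compatible m Rop (Rr a) Rab (Rr b).
  by rewrite /eval3 (mP a b).1 (mP b a).2.
have := eval3_compatible m Rop Rab (Rr b) Rbc.
by rewrite /eval3 (mP b a).2 (mP b c).1.
Qed.

Lemma aut_hom (A : algebra S) (f : aut_group A) : homomorphism f.
Proof. exact: (set_valP f). Qed.

Lemma aut_bij (A : algebra S) (f : aut_group A) : bijective f.
Proof. exact: sym_bij. Qed.

Lemma autP (A : algebra S) (f g : aut_group A) : f =1 g -> f = g.
Proof. by move=> fg; apply/val_inj/symP. Qed.

Definition aut_mk (A : algebra S) (f : A -> A) (f_bij : bijective f)
    (f_hom : homomorphism f) : aut_group A :=
  SigSub (mem_set (f_hom : automorphisms (sym_mk f_bij))).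

Lemma autM (A : algebra S) (f g : aut_group A) a : ((f * g)%g : aut_group A) a = f (g a).
Proof. by []. Qed.

Lemma aut1 (A : algebra S) (a : A) : (1%g : aut_group A) a = a.
Proof. by []. Qed.

Lemma autK (A : algebra S) (f : aut_group A) : cancel f (f^-1%g : aut_group A).
Proof. by move=> a; rewrite -autM mulVg. Qed.

Lemma autVK (A : algebra S) (f : aut_group A) : cancel (f^-1%g : aut_group A) f.
Proof. by move=> a; rewrite -autM mulgV. Qed.

(** The kernel is a congruence; if it were full, surjectivity would leave [A] only one element. *)
Lemma simple_surjective_injective (A : algebra S) (f : A -> A) :
  simple_algebra A -> homomorphism f -> (forall a, exists b, f b = a) -> injective f.
Proof.
move=> [[a [a' aa']] simp] fh fs.
have [] := simp (fun u v => f u = f v).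
- split=> // [u v w -> //|o u v uv]; rewrite !fh; congr interp.
  exact/funext.
- by move=> fE u v /fE.
move=> fE; case: aa'; have [b <-] := fs a; have [b' <-] := fs a'; exact: fE.
Qed.

End Algebras.

(** * Stone spaces *)

Section StonePoints.
Variables (d : Order.disp_t) (B : ctbDistrLatticeType d).
Implicit Types (b c : B) (y : stone B).

Lemma basic_openI b c y :
  basic_open (Order.meet b c) y <-> basic_open b y /\ basic_open c y.
Proof.
have [[[_ yI yU] _] _] := stone_ultra y; split=> [ybc|[yb yc]]; last exact: yI.
by split; apply: yU ybc; [apply: leIl|apply: leIr].
Qed.

Lemma basic_open_meets n (c : 'I_n -> B) y :
  basic_open (\meet_(j < n) c j)%O y <-> forall j, basic_open (c j) y.
Proof.
have yT : basic_open \top%O y by have [[[]]] := stone_ultra y.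
suff all_s (s : seq 'I_n) : basic_open (\meet_(j <- s) c j)%O y <->
    forall j, j \in s -> basic_open (c j) y.
  rewrite all_s; split=> yc j; first by apply: yc; rewrite mem_index_enum.
  by move=> _; apply: yc.
elim: s => [|j s IH]; first by rewrite big_nil.
rewrite big_cons basic_openI IH; split=> [[yj ys] k|ys].
  by rewrite inE => /predU1P[->|/ys].
by split=> [|k ks]; apply: ys; rewrite inE ?eqxx ?ks ?orbT.
Qed.

Lemma basic_openC b y : basic_open (Order.compl b) y <-> ~ basic_open b y.
Proof.
have [[yF y0] ymax] := stone_ultra y; have [yT yI yU] := yF.
split=> [yC yb|yb].
  by apply: y0; rewrite -(Order.CTBDistrLatticeTheory.meetxC b); apply: yI.
apply: contrapT => yC; apply: yb.
(* [G] is the filter generated by [y] and [b]. It is proper, for otherwise some [a] in [y] lies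
   below the complement of [b], which would then be in [y]. *)
pose G := [set c | exists2 a, (\val y : set B) a & (Order.meet a b <= c)%O].
have GE : G = \val y; last first.
  by rewrite /basic_open /= -GE; exists \top%O => //; rewrite meet1x.
apply: ymax; last by move=> c yc; exists c => //; apply: leIl.
split; first split.
- by exists \top%O => //; apply: lex1.
- move=> u v [a ya au] [a' ya' av]; exists (Order.meet a a'); first exact: yI.
  rewrite lexI (le_trans _ au) ?(le_trans _ av) //.
    by rewrite leI2 ?leIr.
  by rewrite leI2 ?leIl.
- by move=> u v uv [a ya au]; exists a => //; apply: le_trans uv.
move=> [a ya]; rewrite lex0 Order.CTBDistrLatticeTheory.disj_leC => ab.
by apply: yC; apply: yU ya.
Qed.

Lemma nbhs_stoneP y (P : set (stone B)) :
  nbhs y P <-> exists2 b, basic_open b y & basic_open b `<=` P.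
Proof.
split=> [|[b yb bP]]; last first.
  by apply: filterS bP _; apply: open_nbhs_nbhs; split=> //; apply: basic_open_open.
rewrite nbhsE => -[U [[O' /= OB <-] [V OV Vy]] UP].
have [b _ bV] := OB _ OV; exists b; first by rewrite bV.
by rewrite bV => z Vz; apply: UP; exists V.
Qed.

Lemma nbhs_basic_open b y : basic_open b y -> nbhs y (basic_open b).
Proof. by move=> yb; apply/nbhs_stoneP; exists b. Qed.

(** Continuity into the discrete space [T], as in [continuous_discreteP]. *)
Definition locally_constant (T : Type) (f : stone B -> T) :=
  forall y, nbhs y (f @^-1` [set f y]).

Lemma locally_constant_mem b : locally_constant (fun y => `[< basic_open b y >]).
Proof.
move=> y; have [yb|yb] := pselect (basic_open b y).
  apply: filterS (nbhs_basic_open yb) => z zb.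
  by rewrite /preimage /= !asboolT.
apply: filterS (nbhs_basic_open ((basic_openC b y).2 yb)) => z /basic_openC zb.
by rewrite /preimage /= !asboolF.
Qed.

End StonePoints.

(** * Homomorphisms of a filtered Boolean power onto [A] *)

Section FilteredBooleanPower.
Variables (S : signature) (A : algebra S) (d : Order.disp_t).
Variables (B : ctbDistrLatticeType d) (n : nat) (e : 'I_n -> A).
Variables (x : 'I_n -> stone B) (e_idem : forall i, idempotent_element (e i)).

Local Notation D := (filtered_boolean_power x e_idem).
Implicit Types (f g : D) (b c : B) (y : stone B).

Lemma filteredP f g : (forall y, bp_proj y f = bp_proj y g) -> f = g.
Proof. by move=> fg; apply/val_inj/val_inj/funext. Qed.

Lemma bp_proj_hom y : homomorphism (bp_proj y : D -> A).
Proof. by []. Qed.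

Lemma bp_proj_x i f : bp_proj (x i) f = e i.
Proof. exact: (set_valP f). Qed.

Lemma bp_proj_locally_constant f : locally_constant (fun y => bp_proj y f).
Proof. exact/continuous_discreteP/(set_valP (\val f)). Qed.

Definition filtered_mk (u : stone B -> A) (u_lc : locally_constant u)
    (ux : forall i, u (x i) = e i) : D :=
  let u' : boolean_power A B :=
    SigSub (mem_set ((continuous_discreteP u).2 u_lc : continuous_functions _)) in
  SigSub (mem_set (ux : filtered_functions e x u')).

Definition agree b f g := forall y, basic_open b y -> bp_proj y f = bp_proj y g.

Lemma nbhs_agree y f g : bp_proj y f = bp_proj y g ->
  nbhs y [set z | bp_proj z f = bp_proj z g].
Proof.
move=> fg; apply: filterS2 (bp_proj_locally_constant f y)
  (bp_proj_locally_constant g y) => z.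
by rewrite /preimage /= => -> ->.
Qed.

Lemma agree_at y f g : bp_proj y f = bp_proj y g ->
  exists2 b, basic_open b y & agree b f g.
Proof. by move=> /nbhs_agree /nbhs_stoneP. Qed.

Definition glue b f g : D.
Proof.
apply: (@filtered_mk (fun y => if `[< basic_open b y >] then bp_proj y f else bp_proj y g)).
  move=> y; apply: filterS3 (locally_constant_mem b y)
    (bp_proj_locally_constant f y) (bp_proj_locally_constant g y) => z.
  by rewrite /preimage /= => -> -> ->.
by move=> i; rewrite !bp_proj_x if_same.
Defined.

Lemma glue_in b f g y : basic_open b y -> bp_proj y (glue b f g) = bp_proj y f.
Proof. by move=> yb; rewrite /bp_proj /= asboolT. Qed.

Lemma glue_out b f g y : ~ basic_open b y -> bp_proj y (glue b f g) = bp_proj y g.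
Proof. by move=> yb; rewrite /bp_proj /= asboolF. Qed.

(** The source of elements of [D] with prescribed values: any value on a clopen set avoiding the
    [x i], and the value [e i] on one containing no marked point but [x i]. *)
Lemma constant_patch b (a : A) f : (forall i, basic_open b (x i) -> e i = a) ->
  exists g : D, (forall y, basic_open b y -> bp_proj y g = a) /\
    forall y, ~ basic_open b y -> bp_proj y g = bp_proj y f.
Proof.
move=> ba.
pose u y := if `[< basic_open b y >] then a else bp_proj y f.
have u_lc : locally_constant u.
  move=> y; apply: filterS2 (locally_constant_mem b y)
    (bp_proj_locally_constant f y) => z.
  by rewrite /preimage /= /u => -> ->.
have ux i : u (x i) = e i.
  by rewrite /u; case: asboolP => [/ba //|_]; rewrite bp_proj_x.
exists (filtered_mk u_lc ux).
by split=> y yb; rewrite -[LHS]/(u y) /u; case: asboolP.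
Qed.

(** The marked points other than [y] form a finite set, which is closed because the Stone space is
    T1. *)
Lemma separating_nbhs y (P : set (stone B)) : nbhs y P -> exists b,
  [/\ basic_open b y, basic_open b `<=` P & forall i, basic_open b (x i) -> x i = y].
Proof.
move=> yP; have : nbhs y (P `&` ~` (range x `\ y)).
  apply: filterI yP _; apply: open_nbhs_nbhs; split; last by move=> [_ /(_ erefl)].
  rewrite openC; have [+ _] := @accessible_finite_set_closed (stone B).
  by apply; [apply: stone_accessible|apply/finite_setD/finite_image].
move=> /nbhs_stoneP[b yb bP]; exists b; split=> // [z /bP[] //|i /bP[_ nr]].
by apply: contrapT => xy; apply: nr; split; first by exists i.
Qed.

Lemma separating_basic_open y : exists b,
  basic_open b y /\ forall i, basic_open b (x i) -> x i = y.
Proof.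
have [b [yb _ bx]] := separating_nbhs (filterT : nbhs y setT).
by exists b.
Qed.

Hypothesis x_inj : injective x.

Lemma filtered_nonempty (a : A) : inhabited D.
Proof.
have /choice[c cP] := fun i => separating_basic_open (x i).
(* The sets [c i] may overlap, but [x j] lies in [c i] only for [i = j], so the pick is forced at
   the marked points. Elsewhere it depends only on the memberships in the [c i], which are locally
   constant. *)
pose u y := if [pick i | `[< basic_open (c i) y >]] is Some i then e i else a.
have u_lc : locally_constant u.
  move=> y; have : nbhs y (fun z => forall i,
      `[< basic_open (c i) z >] = `[< basic_open (c i) y >]).
    apply: (@filter_forall _ _ (fun i z =>
      `[< basic_open (c i) z >] = `[< basic_open (c i) y >]) _ (nbhs_filter y)) => i.
    exact: locally_constant_mem.
  by apply: filterS => z zy; rewrite /preimage /= /u (eq_pick zy).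
have ux i : u (x i) = e i.
  rewrite /u; case: pickP => [j /asboolP /(cP j).2 /x_inj -> //|/(_ i)].
  by rewrite asboolT //; apply: (cP i).1.
exact: (inhabits (filtered_mk u_lc ux)).
Qed.

Lemma bp_proj_surj y a : punctured x y -> exists f : D, bp_proj y f = a.
Proof.
move=> yx; have [f0] := filtered_nonempty a.
have [b [yb bx]] := separating_basic_open y.
have [|f [fb _]] := @constant_patch b a f0; last by exists f; apply: fb.
by move=> i /bx xy; case: yx; exists i.
Qed.

(** Encodes a clopen set away from the [x i] by a pair of elements of [D], to which automorphisms
    can be applied. *)
Lemma differ_on b (a a' : A) : a <> a' -> (forall i, ~ basic_open b (x i)) ->
  exists f g : D, forall y, bp_proj y f = bp_proj y g <-> ~ basic_open b y.
Proof.
move=> aa' bx; have [f0] := filtered_nonempty a.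
have [i /bx //|f [fb fC]] := @constant_patch b a f0.
have [i /bx //|g [gb gC]] := @constant_patch b a' f0.
exists f, g => z; split=> [fg zb|zb]; last by rewrite fC ?gC.
by move: fg; rewrite fb ?gb.
Qed.

(** * Factoring a surjection onto [A] through evaluation at a point *)

Section HomOnto.
Variable rho : D -> A.
Hypotheses (A_simple : simple_algebra A) (A_malcev : malcev A).
Hypothesis A_nonabelian : ~ abelian_algebra A.
Hypotheses (rho_hom : homomorphism rho) (rho_surj : forall a, exists f, rho f = a).

Definition agree_rel b (a a' : A) := exists f g, [/\ agree b f g, rho f = a & rho g = a'].

(** [agree_rel b] is the image of a congruence of [D] under a surjection, so it is reflexive and
    compatible. By the Mal'cev term it is a congruence, and simplicity leaves two cases. *)
Lemma agree_rel_full b : (forall f g, agree b f g -> rho f = rho g) \/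
  (forall a a', agree_rel b a a').
Proof.
have cong : congruence (agree_rel b).
  apply: malcev_congruence => // [a|o u v /choice[F /choice[G FG]]].
    by have [f fa] := rho_surj a; exists f, f.
  exists (interp F), (interp G); split.
  - move=> y yb; rewrite !bp_proj_hom; congr interp; apply/funext => j /=.
    by have [/(_ _ yb)] := FG j.
  - by rewrite rho_hom; congr interp; apply/funext => j /=; have [] := FG j.
  - by rewrite rho_hom; congr interp; apply/funext => j /=; have [] := FG j.
have [eqR|fullR] := A_simple.2 _ cong; [left=> f g fg|by right].
by apply/eqR; exists f, g.
Qed.

(* Lifts [f], [g], [h] of any [a], [b], [c] with [f = g] on one part of the
   clopen partition and [g = h] on the other make each side of the identity
   [m (t f) (t g) (t h) = t (m f g h)] equal to [t h], resp. [t f], there. *)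
Lemma agree_rel_full_abelian b :
  (forall a a', agree_rel b a a') -> (forall a a', agree_rel (Order.compl b) a a') ->
  abelian_algebra A.
Proof.
have [m mP] := A_malcev.
have mxxy (u v : A) : eval3 m u u v = v by apply: (mP u v).1.
have mxyy (u v : A) : eval3 m u v v = u by apply: (mP v u).2.
(* If [f] and [h] agree on [c], with images [a] and [rho g], then [m f h g] equals [g] on [c] and
   has image [m a (rho g) (rho g) = a]. *)
have lift c g a : (forall a a', agree_rel c a a') -> exists2 f, agree c f g & rho f = a.
  move=> full; have [f [h [fh fa hg]]] := full a (rho g).
  exists (eval3 m f h g); last by rewrite homomorphism_eval3 // fa hg mxyy.
  by move=> y yc; rewrite (homomorphism_eval3 _ _ _ _ (bp_proj_hom y)) fh.
move=> full fullC.
have lifts (t : A * A * A) : exists F : D * D * D,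
    [/\ agree b F.1.1 F.1.2, agree (Order.compl b) F.1.2 F.2 &
        (rho F.1.1, rho F.1.2, rho F.2) = t].
  case: t => [[u v] w]; have [g <-] := rho_surj v.
  have [f fg <-] := lift b g u full; have [h hg <-] := lift _ g w fullC.
  by exists (f, g, h); split=> // y /hg.
have commute (V : Type) (t : term S V) (u v w : V -> A) :
    term_eval (fun j => eval3 m (u j) (v j) (w j)) t =
    eval3 m (term_eval u t) (term_eval v t) (term_eval w t).
  have /choice[F FP] := fun j => lifts (u j, v j, w j).
  have [uE vE wE] : [/\ u = rho \o (fun j => (F j).1.1),
      v = rho \o (fun j => (F j).1.2) & w = rho \o (fun j => (F j).2)].
    by split; apply/funext => j /=; have [_ _ []] := FP j.
  have -> : (fun j => eval3 m (u j) (v j) (w j)) =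
      rho \o (fun j => eval3 m (F j).1.1 (F j).1.2 (F j).2).
    by apply/funext => j; rewrite /= homomorphism_eval3 // uE vE wE.
  rewrite uE vE wE -!homomorphism_term // -homomorphism_eval3 //.
  congr rho; apply: filteredP => y.
  rewrite (homomorphism_eval3 _ _ _ _ (bp_proj_hom y)).
  rewrite !(homomorphism_term _ _ (bp_proj_hom y)).
  have ev (a c h : V -> D) : bp_proj y \o (fun j => eval3 m (a j) (c j) (h j)) =
      fun j => eval3 m (bp_proj y (a j)) (bp_proj y (c j)) (bp_proj y (h j)).
    by apply/funext => j /=; rewrite (homomorphism_eval3 _ _ _ _ (bp_proj_hom y)).
  rewrite ev; have [yb|/basic_openC yb] := pselect (basic_open b y).
    have e12 : bp_proj y \o (fun j => (F j).1.1) = bp_proj y \o (fun j => (F j).1.2).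
      by apply/funext => j /=; have [/(_ y yb)] := FP j.
    rewrite e12 mxxy; congr term_eval; apply/funext => j /=.
    by have [/(_ y yb) -> _ _] := FP j; rewrite mxxy.
  have e23 : bp_proj y \o (fun j => (F j).1.2) = bp_proj y \o (fun j => (F j).2).
    by apply/funext => j /=; have [_ /(_ y yb)] := FP j.
  rewrite e23 mxyy; congr term_eval; apply/funext => j /=.
  by have [_ /(_ y yb) -> _] := FP j; rewrite mxyy.
have [o _] := A_simple.1.
(* [commute] for the term [m] is the interchange law; for a basic operation applied to variables it
   says that this operation commutes with [m]. *)
apply: (@commuting_malcev_abelian _ _ (eval3 m) o) => //.
  move=> a1 a2 a3 b1 b2 b3 c1 c2 c3.
  rewrite {2 3 4}/eval3 -commute /eval3; congr term_eval.
  by apply/funext => -[[|[|[|]]]].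
by move=> f u v w; rewrite -(commute _ (App (fun j => Var S j))).
Qed.

Lemma agree_or b : (forall f g, agree b f g -> rho f = rho g) \/
  (forall f g, agree (Order.compl b) f g -> rho f = rho g).
Proof.
have [|full] := agree_rel_full b; first by left.
have [|fullC] := agree_rel_full (Order.compl b); first by right.
by case: A_nonabelian; apply: agree_rel_full_abelian full fullC.
Qed.

Lemma agree_ultrafilter :
  ultrafilter [set b | forall f g, agree b f g -> rho f = rho g].
Proof.
have [a [a' aa']] := A_simple.1.
split; first split; first split.
- move=> f g fg; congr rho; apply: filteredP => y; apply: fg.
  by have [[[]]] := stone_ultra y.
(* The element equal to [f] on [b] and to [g] off [b] agrees with [f] on [b], and with [g] on
   [c]. *)
- move=> b c bF cF f g fg; rewrite -(bF (glue b f g) f); last first.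
    by move=> y yb; rewrite glue_in.
  apply: cF => y yc; have [yb|yb] := pselect (basic_open b y).
    by rewrite glue_in //; apply/fg/basic_openI.
  by rewrite glue_out.
- move=> b c bc bF f g fg; apply: bF => y yb; apply: fg.
  by have [[[_ _ yU] _] _] := stone_ultra y; apply: yU bc yb.
- move=> /= bot; have [f fa] := rho_surj a; have [g ga'] := rho_surj a'.
  apply: aa'; rewrite -fa -ga'; apply: bot => y y0.
  by have [[_]] := stone_ultra y.
(* Maximality: by [agree_or] a member [b] of [G] is already in the set, or its complement is; the
   latter would put bottom into [G]. *)
move=> G [[_ GI _] G0] FG; apply/seteqP; split=> // b Gb.
have [//|/FG GC] := agree_or b; case: G0.
by rewrite -(Order.CTBDistrLatticeTheory.meetxC b); apply: GI.
Qed.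

Lemma hom_onto_factor : exists (y : punctured x) (alpha : aut_group A),
  forall f, rho f = alpha (bp_proj (\val y) f).
Proof.
pose y : stone B := SigSub (mem_set agree_ultrafilter).
have rhoE f g : bp_proj y f = bp_proj y g -> rho f = rho g.
  by move=> /agree_at[b yb]; apply: yb.
(* All elements of [D] agree at [x i], so [y = x i] would make [rho] constant. *)
have yx : punctured x y.
  move=> [i _ xy]; have [a [a' []]] := A_simple.1.
  have [f <-] := rho_surj a; have [g <-] := rho_surj a'.
  by apply: rhoE; rewrite -xy !bp_proj_x.
(* [s] is a section of evaluation at [y]. Since [rho f] depends only on the value of [f] at [y], the
   map [rho \o s] is the wanted automorphism. *)
have /choice[s sP] := fun a => bp_proj_surj a yx.
have alpha_hom : homomorphism (rho \o s).
  move=> o u; rewrite /= -[RHS](rho_hom (s \o u)); apply: rhoE.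
  by rewrite sP bp_proj_hom; congr interp; apply/funext => j /=; rewrite sP.
have alpha_surj a : exists a', (rho \o s) a' = a.
  by have [f <-] := rho_surj a; exists (bp_proj y f); apply/rhoE/sP.
have alpha_inj := simple_surjective_injective A_simple alpha_hom alpha_surj.
exists (SigSub (mem_set yx)).
exists (aut_mk (inj_surj_bijective alpha_inj alpha_surj) alpha_hom) => f.
by apply: rhoE; rewrite sP.
Qed.

End HomOnto.

End FilteredBooleanPower.

(** * Split extensions *)

Section Groups.
Local Open Scope group_scope.

Definition multiplicative_mk (G H : groupType) (f : G -> H)
    (fM : {morph f : u v / u * v}) : {multiplicative G -> H} :=
  HB.pack f (isMultiplicative.Build G H f fM).

Lemma multiplicative1 (G H : groupType) (f : {multiplicative G -> H}) : f 1 = 1.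
Proof. by apply: (@mulgI _ (f 1)); rewrite -gmulfM !mulg1. Qed.

Lemma multiplicativeV (G H : groupType) (f : {multiplicative G -> H}) u :
  f u^-1 = (f u)^-1.
Proof. by apply: (@mulgI _ (f u)); rewrite -gmulfM !mulgV multiplicative1. Qed.

Lemma hom_kernelP (G H : groupType) (h : {multiplicative G -> H}) (k : hom_kernel h) :
  h (\val k) = 1.
Proof. exact: (set_valP k). Qed.

(** [H] acts on the kernel by conjugation through [s], and [g] factors as [g * (s (h g))^-1], an
    element of the kernel, times [s (h g)]. *)
Lemma split_semidirect (G H : groupType) (h : {multiplicative G -> H})
    (s : {multiplicative H -> G}) : cancel s h ->
  exists (act : group_action H (hom_kernel h))
    (F : {multiplicative G -> semidirect act}), bijective F.
Proof.
move=> sK.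
pose ker g (hg : h g = 1) : hom_kernel h := SigSub (mem_set (hg : hom_kernel_set h g)).
have actK u (k : hom_kernel h) : h (s u * \val k * s u^-1) = 1.
  by rewrite !gmulfM !sK hom_kernelP mulg1 mulgV.
pose act u k := ker _ (actK u k).
have actM u : {morph act u : k l / k * l}.
  move=> k l; apply: val_inj; rewrite /= !multiplicativeV.
  by rewrite !mulgA mulgVK.
have act1 k : act 1 k = k.
  by apply: val_inj; rewrite /= invg1 !multiplicative1 mul1g mulg1.
have actA u v k : act (u * v) k = act u (act v k).
  by apply: val_inj; rewrite /= invgM !gmulfM !mulgA.
pose alpha := GroupAction actM act1 actA.
have FK g : h (g * s (h g)^-1) = 1 by rewrite gmulfM sK mulgV.
pose F g : semidirect alpha := (ker _ (FK g), h g).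
have FM : {morph F : g g' / g * g'}.
  move=> g g'; rewrite {3}/F -[RHS]/(_, _); congr (_, _); last exact: gmulfM.
  apply: val_inj; rewrite /= gmulfM invgM gmulfM !multiplicativeV !mulgA.
  by rewrite mulgVK.
exists alpha, (multiplicative_mk FM).
exists (fun p : semidirect alpha => \val p.1 * s p.2) => [g|[k u]].
  by rewrite /= multiplicativeV mulgVK.
rewrite /= /F; have hku : h (\val k * s u) = u by rewrite gmulfM hom_kernelP mul1g sK.
congr (_, _) => //; apply: val_inj => /=.
by rewrite hku multiplicativeV mulgK.
Qed.

End Groups.

(** * Automorphisms obtained from a group action *)

Section Actions.
Variables (S : signature) (D : algebra S) (G : groupType) (act : G -> D -> D).
Hypotheses (act1 : forall f, act 1%g f = f)
  (actM : forall u v f, act (u * v)%g f = act u (act v f))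
  (act_hom : forall u, homomorphism (act u)).

Lemma act_bij u : bijective (act u).
Proof.
by exists (act u^-1%g) => f; rewrite -actM ?mulgV ?mulVg act1.
Qed.

Definition act_aut u : aut_group D := aut_mk (act_bij u) (@act_hom u).

Lemma act_autE u f : act_aut u f = act u f. Proof. by []. Qed.

Lemma act_autM : {morph act_aut : u v / (u * v)%g}.
Proof. by move=> u v; apply: autP => f; rewrite autM !act_autE actM. Qed.

End Actions.

(** * Automorphisms *)

Section Punctured.
Variables (d : Order.disp_t) (B : ctbDistrLatticeType d) (n : nat).
Variable x : 'I_n -> stone B.

Lemma punctured_cases y : (exists i, y = x i) \/ exists z : punctured x, y = \val z.
Proof.
have [yx|nyx] := pselect (punctured x y).
  by right; exists (SigSub (mem_set yx)).
by left; have [i _ <-] := contrapT nyx; exists i.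
Qed.

Lemma insub_puncturedN i : insub (x i) = None :> option (punctured x).
Proof. by apply: insubN; apply/negP => /set_mem; apply; exists i. Qed.

(** Points outside [punctured x] satisfy the condition on the right vacuously, so subspace
    neighbourhoods become neighbourhoods in the Stone space. *)
Lemma nbhs_puncturedP (z : punctured x) (Q : set (punctured x)) :
  nbhs z Q <-> nbhs (\val z) [set y | forall w : punctured x, \val w = y -> Q w].
Proof.
split=> [[U [[V oV <-] Vz VU]]|].
  apply: (@filterS _ _ _ V); last exact: open_nbhs_nbhs.
  by move=> y Vy w wy; apply: VU; move: Vy; rewrite -wy.
rewrite nbhsE => -[V [oV Vz] VQ].
exists (\val @^-1` V); split=> //; first by exists V.
by move=> w /VQ; apply.
Qed.

End Punctured.

Section Automorphisms.
Variables (S : signature) (A : algebra S) (n : nat) (e : 'I_n -> A).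
Variables (d : Order.disp_t) (B : ctbDistrLatticeType d) (x : 'I_n -> stone B).
Hypothesis A_finite : finite_set [set: A].
Hypothesis A_simple : simple_algebra A.
Hypothesis A_malcev : malcev A.
Hypothesis A_nonabelian : ~ abelian_algebra A.
Hypothesis e_idem : forall i, idempotent_element (e i).
Hypothesis e_orbits : forall i j, i <> j -> ~ exists alpha : aut_group A, alpha (e i) = e j.
Hypothesis x_inj : injective x.

Local Notation D := (filtered_boolean_power x e_idem).
Implicit Types (phi psi : aut_group D) (z w : punctured x) (f g : D) (y : stone B).

(** Joins the defining conditions of [phi_circ] and [phi_at] in one relation: both values are then
    found by exhibiting any [w] and [alpha] that satisfy it. *)
Definition carries phi z w (alpha : aut_group A) :=
  forall f, alpha (bp_proj (\val z) f) = bp_proj (\val w) (phi f).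

Lemma carries_ex phi z : exists w alpha, carries phi z w alpha.
Proof.
have [|a|w [beta betaE]] := @hom_onto_factor _ _ _ _ _ _ _ e_idem x_inj
    (fun f => bp_proj (\val z) ((phi^-1%g : aut_group D) f))
    A_simple A_malcev A_nonabelian.
- by move=> o u; rewrite (aut_hom (phi^-1%g : aut_group D)) bp_proj_hom.
- have [f fa] := bp_proj_surj e_idem x_inj a (set_valP z).
  by exists (phi f); rewrite autK.
exists w, beta^-1%g => f.
by rewrite -[f in LHS](autK phi) betaE autK.
Qed.

Lemma carries_theta phi z w alpha : carries phi z w alpha ->
  image_rel phi (theta (\val z)) = theta (\val w).
Proof.
move=> c; apply/seteqP; split=> [_ [[f g] /= fg <-]|[f g] /= fg].
  by rewrite /theta /= -!c fg.
exists ((phi^-1%g : aut_group D) f, (phi^-1%g : aut_group D) g).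
  by apply: (bij_inj (aut_bij alpha)); rewrite /= !c !autVK.
by rewrite /= !autVK.
Qed.

(** If [z] and [w] differ, some clopen set around [w] omits [z] and all [x i]; two elements of [D]
    differing exactly there are identified at [z] but not at [w]. *)
Lemma theta_inj z w :
  theta (\val z) = theta (\val w) :> set (D * D) -> z = w.
Proof.
move=> zw; apply: contrapT => nzw; have [a [a' aa']] := A_simple.1.
have : nbhs (\val w) (~` [set \val z]).
  apply: open_nbhs_nbhs; split; last by move=> /val_inj /esym.
  rewrite openC; have [+ _] := @accessible_finite_set_closed (stone B).
  by apply; [apply: stone_accessible|apply: finite_set1].
move=> /(@separating_nbhs _ _ _ x)[b [wb bz bx]].
have [|f [g fg]] := differ_on e_idem x_inj (b := b) aa'.
  by move=> i /bx xw; apply: (set_valP w); exists i.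
suff : theta (\val w) (f, g) by move/fg.
by rewrite -zw; apply/fg => /bz; apply.
Qed.

Lemma phi_circE phi z w alpha : carries phi z w alpha -> phi_circ phi z = w.
Proof.
move=> c; apply: xget_unique => [|w'] /=; rewrite (carries_theta c) //.
by move=> /theta_inj.
Qed.

Lemma phi_atE phi z w alpha : carries phi z w alpha -> phi_at phi z = alpha.
Proof.
move=> c; apply: xget_unique => [f|beta betaP] /=; first by rewrite (phi_circE c).
apply: autP => a; have [f <-] := bp_proj_surj e_idem x_inj a (set_valP z).
by rewrite c -(phi_circE c); apply: betaP.
Qed.

Lemma phi_carries phi z : carries phi z (phi_circ phi z) (phi_at phi z).
Proof. by have [w [alpha c]] := carries_ex phi z; rewrite (phi_circE c) (phi_atE c). Qed.

Lemma carriesM phi psi z w w' alpha beta : carries psi z w alpha ->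
  carries phi w w' beta -> carries (phi * psi)%g z w' (beta * alpha)%g.
Proof. by move=> c c' f; rewrite !autM c c'. Qed.

(** * The permutation of the Stone space induced by an automorphism *)

Lemma phi_bar_x phi i : phi_bar phi (x i) = x i.
Proof. by rewrite /phi_bar insub_puncturedN. Qed.

Lemma phi_bar_val phi z : phi_bar phi (\val z) = \val (phi_circ phi z).
Proof. by rewrite /phi_bar valK. Qed.

Lemma phi_barM phi psi y : phi_bar (phi * psi)%g y = phi_bar phi (phi_bar psi y).
Proof.
have [[i ->]|[z ->]] := punctured_cases x y; first by rewrite !phi_bar_x.
rewrite !phi_bar_val; congr \val; apply: phi_circE.
by apply: carriesM; apply: phi_carries.
Qed.

Lemma phi_bar1 y : phi_bar (1%g : aut_group D) y = y.
Proof.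
have [[i ->]|[z ->]] := punctured_cases x y; first by rewrite phi_bar_x.
rewrite phi_bar_val; congr \val; apply: (@phi_circE _ _ _ 1%g) => f.
by rewrite !aut1.
Qed.

Lemma phi_barK phi : cancel (phi_bar phi) (phi_bar (phi^-1%g : aut_group D)).
Proof. by move=> y; rewrite -phi_barM mulVg phi_bar1. Qed.

Lemma phi_barVK phi : cancel (phi_bar (phi^-1%g : aut_group D)) (phi_bar phi).
Proof. by move=> y; rewrite -phi_barM mulgV phi_bar1. Qed.

(* The preimage of [b] is the clopen set where the two functions carried by [phi]
   to functions differing exactly on [b] differ. *)
Lemma phi_bar_preimage phi b : (forall i, ~ basic_open b (x i)) ->
  locally_constant (fun y => `[< basic_open b (phi_bar phi y) >]).
Proof.
move=> bx; have [a [a' aa']] := A_simple.1.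
have [u [v uv]] := differ_on e_idem x_inj aa' bx.
pose f : D := (phi^-1%g : aut_group D) u; pose g : D := (phi^-1%g : aut_group D) v.
have preb y : basic_open b (phi_bar phi y) <-> bp_proj y f <> bp_proj y g.
  have [[i ->]|[z ->]] := punctured_cases x y.
    by rewrite phi_bar_x !bp_proj_x; split=> // /bx.
  rewrite phi_bar_val; split=> [zb fg|fg].
    by apply: (iffLR (uv _) _ zb); rewrite -[u](autVK phi) -[v](autVK phi) -!phi_carries fg.
  apply: contrapT => /(iffRL (uv _)); rewrite -[u](autVK phi) -[v](autVK phi) -!phi_carries.
  by move/(bij_inj (aut_bij _)).
move=> y; apply: filterS2 (bp_proj_locally_constant f y)
  (bp_proj_locally_constant g y) => z.
rewrite /preimage /= => fz gz; congr asbool; apply/propext.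
by rewrite !preb fz gz.
Qed.

Lemma phi_bar_continuous phi : continuous (phi_bar phi).
Proof.
suff near_y y b0 : basic_open b0 (phi_bar phi y) ->
    nbhs y [set w | basic_open b0 (phi_bar phi w)].
  by move=> y P /nbhs_stoneP[b0 /near_y yb0 b0P]; apply: filterS yb0 => w /b0P.
move=> yb0.
have [[i yi]|[z yz]] := punctured_cases x y; last first.
  have [b [yb bb0 bx]] := separating_nbhs x (nbhs_basic_open yb0).
  have bN i : ~ basic_open b (x i).
    move=> /bx; rewrite yz phi_bar_val => xz.
    by apply: (set_valP (phi_circ phi z)); exists i.
  apply: filterS (phi_bar_preimage phi bN y) => w.
  by rewrite /preimage /= [RHS]asboolT // => /asboolP /bb0.
rewrite yi phi_bar_x in yb0 *.
(* Clopen sets [c j] around the marked points, each containing only its own one, with [c i] inside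
   the target [b0]. Near [x i], the images under [phi_bar] will be shown to lie in [c i]. *)
have sep j : exists c, [/\ basic_open c (x j),
    basic_open c `<=` [set w | j = i -> basic_open b0 w] &
    forall k, basic_open c (x k) -> x k = x j].
  apply: (@separating_nbhs _ _ _ x).
  have [->|ji] := eqVneq j i; first by apply: filterS (nbhs_basic_open yb0) => w wb _.
  by apply: filterS filterT => w _ /eqP; rewrite (negbTE ji).
have {sep} /choice[c cP] := sep.
have c_avoid j : j <> i -> nbhs (x i) [set w | ~ basic_open (c j) (phi_bar phi w)].
  move=> ji; have [f0] := filtered_nonempty e_idem x_inj (e i).
  have [_ _ cj] := cP j.
  have cje k : basic_open (c j) (x k) -> e k = e j by move=> /cj/x_inj ->.
  (* [u] is [e j] on [c j], while its preimage [f] under [phi] is [e i] near [x i]. A point near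
     [x i] sent into [c j] would give an automorphism of [A] taking [e i] to [e j]. *)
  have [u [uc _]] := constant_patch f0 cje.
  pose f : D := (phi^-1%g : aut_group D) u.
  apply: filterS (bp_proj_locally_constant f (x i)) => w.
  rewrite /preimage /= bp_proj_x => fw.
  have [[k wk]|[z wz]] := punctured_cases x w.
    rewrite wk phi_bar_x => /cj/x_inj kj.
    apply: (e_orbits (nesym ji)); exists 1%g.
    by rewrite aut1 -fw wk bp_proj_x kj.
  rewrite wz phi_bar_val => /uc uz; apply: (e_orbits (nesym ji)).
  by exists (phi_at phi z); rewrite -fw wz phi_carries autVK.
(* The region outside all [c j] contains no marked point, so its preimage is clopen and misses
   [x i]. *)
pose C := (\meet_(j < n) Order.compl (c j))%O.
have Cx k : ~ basic_open C (x k).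
  by move=> /basic_open_meets /(_ k) /basic_openC; apply; have [] := cP k.
have C_avoid : nbhs (x i) [set w | ~ basic_open C (phi_bar phi w)].
  apply: filterS (phi_bar_preimage phi Cx (x i)) => w.
  by rewrite /preimage /= phi_bar_x [RHS]asboolF // => /asboolP.
have cs_avoid : nbhs (x i) [set w | forall j, j <> i -> ~ basic_open (c j) (phi_bar phi w)].
  apply: (@filter_forall _ _ (fun j (w : stone B) =>
    j <> i -> ~ basic_open (c j) (phi_bar phi w)) _ (nbhs_filter (x i))) => j.
  have [->|/eqP ji] := eqVneq j i; first by apply: filterS filterT.
  by apply: filterS (c_avoid j ji).
apply: filterS2 C_avoid cs_avoid => w wC wc.
apply: contrapT => wb; apply: wC; apply/basic_open_meets => j; apply/basic_openC.
have [->|/eqP ji] := eqVneq j i; last exact: wc.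
by have [_ cb _] := cP i => /cb /(_ erefl).
Qed.

(** * The homomorphism to homeomorphisms and its section *)

Definition bar_sym phi : symmetric_group (stone B) :=
  sym_mk (Bijective (phi_barK phi) (phi_barVK phi)).

Lemma bar_symV phi : (bar_sym phi)^-1%g = bar_sym (phi^-1%g).
Proof.
apply: (mulgI (bar_sym phi)); rewrite mulgV; apply: symP => y.
by rewrite symM; apply/esym/phi_barVK.
Qed.

Lemma bar_homeo phi : homeomorphisms_fixing x (bar_sym phi).
Proof.
split; [exact: phi_bar_continuous|rewrite bar_symV; exact: phi_bar_continuous|].
exact: phi_bar_x.
Qed.

Definition bar_homeo_group phi : homeo_group x := SigSub (mem_set (bar_homeo phi)).

Lemma homeoP (g g' : homeo_group x) : g =1 g' -> g = g'.
Proof. by move=> gg'; apply/val_inj/symP. Qed.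

Lemma bar_homeoM : {morph bar_homeo_group : phi psi / (phi * psi)%g}.
Proof. by move=> phi psi; apply: homeoP => y; apply: phi_barM. Qed.

Lemma homeo_fix (g : homeo_group x) i : g (x i) = x i.
Proof. by have [_ _ fix_g] := set_valP g; apply: fix_g. Qed.

Lemma homeo_continuous (g : homeo_group x) : continuous (g : stone B -> stone B).
Proof. by have [cont_g _ _] := set_valP g. Qed.

(** Composition with the inverse of [g] makes this a left action; the values at the [x i] persist
    because [g] fixes these points. *)
Definition homeo_act (g : homeo_group x) (f : D) : D.
Proof.
apply: (@filtered_mk _ _ _ _ _ _ _ e_idem
  (fun y => bp_proj ((g^-1%g : homeo_group x) y) f)) => [y|i].
  exact: homeo_continuous (bp_proj_locally_constant f _).
by rewrite homeo_fix bp_proj_x.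
Defined.

Lemma homeo_actE (g : homeo_group x) f y :
  bp_proj y (homeo_act g f) = bp_proj ((g^-1%g : homeo_group x) y) f.
Proof. by []. Qed.

Lemma homeo_act1 f : homeo_act 1%g f = f.
Proof. by apply: filteredP => y; rewrite homeo_actE invg1. Qed.

Lemma homeo_actM (g g' : homeo_group x) f : homeo_act (g * g')%g f = homeo_act g (homeo_act g' f).
Proof. by apply: filteredP => y; rewrite !homeo_actE invgM. Qed.

Lemma homeo_act_hom (g : homeo_group x) : homomorphism (homeo_act g).
Proof. by move=> o u; apply: filteredP. Qed.

Definition homeo_aut : {multiplicative homeo_group x -> aut_group D} :=
  multiplicative_mk (act_autM homeo_act1 homeo_actM homeo_act_hom).

(** The image of [f] has at [g z] the value of [f] at [z], so [z] is carried to [g z] by the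
    identity of [A]. *)
Lemma bar_homeo_aut (g : homeo_group x) : bar_homeo_group (homeo_aut g) = g.
Proof.
apply: homeoP => y; rewrite -[LHS]/(phi_bar (homeo_aut g) y).
have [[i ->]|[z ->]] := punctured_cases x y; first by rewrite phi_bar_x homeo_fix.
have gz : punctured x (g (\val z)).
  move=> [i _ xi]; apply: (set_valP z); exists i => //.
  by apply: (bij_inj (sym_bij (\val g))); rewrite -[LHS]/(g (x i)) homeo_fix.
rewrite phi_bar_val.
rewrite (@phi_circE _ _ (SigSub (mem_set gz)) 1%g) // => f.
by rewrite aut1 act_autE homeo_actE /=; congr bp_proj; apply/esym/(symK (\val g)).
Qed.

Definition bar_morph : {multiplicative aut_group D -> homeo_group x} :=
  multiplicative_mk bar_homeoM.

(** * Coordinates of the elements of the kernel *)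

Lemma kernel_circ (phi : hom_kernel bar_morph) z : phi_circ (\val phi) z = z.
Proof.
apply: val_inj; rewrite /= -phi_bar_val.
exact: (congr1 (fun g : homeo_group x => g (\val z)) (hom_kernelP phi)).
Qed.

Lemma kernel_carries (phi : hom_kernel bar_morph) z :
  carries (\val phi) z z (phi_at (\val phi) z).
Proof. by have := phi_carries (\val phi) z; rewrite kernel_circ. Qed.

Lemma phi_star_K phi : (forall z, carries phi z z (phi_at phi z)) ->
  K_set e (phi_star phi).
Proof.
move=> c; apply/K_setP; split=> [z|i].
  apply/nbhs_puncturedP.
  have near_a (a : A) : nbhs (\val z)
      [set y | forall w : punctured x, \val w = y -> phi_at phi w a = phi_at phi z a].
    have [f fa] := bp_proj_surj e_idem x_inj a (set_valP z).
    apply: filterS2 (bp_proj_locally_constant f (\val z))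
      (bp_proj_locally_constant (phi f) (\val z)) => y.
    rewrite /preimage /= fa => fy phify w wy; move: fy phify; rewrite -wy => fw phifw.
    by rewrite -[in LHS]fw c phifw -c fa.
  (* Each [a] gives its own neighbourhood on which the value at [a] is constant; finiteness of [A]
     allows intersecting them all. *)
  have [s sA] := finite_fsetP.1 A_finite.
  have := @filter_bigI _ _ s _ _ (nbhs_filter (\val z)) (fun a _ => near_a a).
  apply: filterS => y; rewrite -sA => yP w wy.
  by apply: autP => a; apply: (yP a).
have [f] := filtered_nonempty e_idem x_inj (e i).
(* Near [x i] both [f] and [phi f] have value [e i], so the automorphism at a punctured point there
   fixes [e i]. Another marked point there would have the same idempotent. *)
apply: filterS2 (bp_proj_locally_constant f (x i))
  (bp_proj_locally_constant (phi f) (x i)) => y.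
rewrite /preimage /= !bp_proj_x => fy phify.
have [[j yj]|[z yz]] := punctured_cases x y; last first.
  by right; exists z => //; rewrite -[in LHS]fy yz c -yz.
left; rewrite yj in fy *; rewrite bp_proj_x in fy; congr x.
by apply: contrapT => ji; apply: (e_orbits ji); exists 1%g.
Qed.

Definition star (phi : hom_kernel bar_morph) : K_group e x :=
  SigSub (mem_set (phi_star_K (kernel_carries phi))).

Lemma starM : {morph star : phi psi / (phi * psi)%g}.
Proof.
move=> phi psi; apply: val_inj; apply/funext => z.
apply: phi_atE; apply: carriesM; exact: kernel_carries.
Qed.

Definition star_morph : {multiplicative hom_kernel bar_morph -> K_group e x} :=
  multiplicative_mk starM.

Lemma star_inj : injective star.
Proof.
move=> phi psi /(congr1 val) /= pp; apply: val_inj; apply: autP => f.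
apply: filteredP => y; have [[i ->]|[z ->]] := punctured_cases x y.
  by rewrite !bp_proj_x.
rewrite -!kernel_carries; congr (aut_fun _ _).
exact: (congr1 (fun k => k z) pp).
Qed.

(** * Inverting [star] by twisting each coordinate *)

Definition K_fun (k : K_group e x) : punctured x -> aut_group A := \val k.

Definition twist_fun (k : K_group e x) (f : D) y : A :=
  if insub y is Some z then K_fun k z (bp_proj y f)
  else bp_proj y f.

Lemma twist_fun_val k f z :
  twist_fun k f (\val z) = K_fun k z (bp_proj (\val z) f).
Proof. by rewrite /twist_fun valK. Qed.

Lemma twist_fun_x k f i : twist_fun k f (x i) = e i.
Proof. by rewrite /twist_fun insub_puncturedN bp_proj_x. Qed.

(** Near [x i] the function [f] has value [e i], which [k] fixes by the stabilizer condition of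
    [K_set]. At a punctured point both [k] and [f] are locally constant. *)
Lemma twist_fun_locally_constant k f : locally_constant (twist_fun k f).
Proof.
have /K_setP [k_lc k_stab] := set_valP k.
move=> y; have [[i ->]|[z ->]] := punctured_cases x y.
  apply: filterS2 (k_stab i) (bp_proj_locally_constant f (x i)) => w.
  rewrite /preimage /= twist_fun_x bp_proj_x => -[-> _|[z <- kz fz]].
    by rewrite twist_fun_x.
  by rewrite twist_fun_val fz.
have kz : nbhs (\val z) [set y | forall w : punctured x, \val w = y ->
    K_fun k w = K_fun k z] by exact/nbhs_puncturedP/k_lc.
have pz : nbhs (\val z) (punctured x).
  by apply: open_nbhs_nbhs; split; [apply: punctured_open|apply: (set_valP z)].
apply: filterS3 pz kz (bp_proj_locally_constant f (\val z)) => w wx.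
have [w' ->] : exists w' : punctured x, w = \val w' by exists (SigSub (mem_set wx)).
by move=> /(_ _ erefl) kw fw; rewrite /preimage /= !twist_fun_val kw fw.
Qed.

Definition twist k f : D :=
  filtered_mk e_idem (twist_fun_locally_constant k f) (twist_fun_x k f).

Lemma bp_proj_twist k f z :
  bp_proj (\val z) (twist k f) = K_fun k z (bp_proj (\val z) f).
Proof. exact: twist_fun_val. Qed.

Lemma filtered_punctured f g :
  (forall z, bp_proj (\val z) f = bp_proj (\val z) g) -> f = g.
Proof.
move=> fg; apply: filteredP => y; have [[i ->]|[z ->]] := punctured_cases x y => //.
by rewrite !bp_proj_x.
Qed.

Lemma twist1 f : twist 1%g f = f.
Proof. by apply: filtered_punctured => z; rewrite bp_proj_twist. Qed.

Lemma twistM k l f : twist (k * l)%g f = twist k (twist l f).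
Proof. by apply: filtered_punctured => z; rewrite !bp_proj_twist. Qed.

Lemma twist_hom k : homomorphism (twist k).
Proof.
move=> o u; apply: filtered_punctured => z.
rewrite bp_proj_twist !bp_proj_hom aut_hom; congr interp.
by apply/funext => j /=; rewrite bp_proj_twist.
Qed.

Definition twist_aut := act_aut twist1 twistM twist_hom.

Lemma twist_carries k z : carries (twist_aut k) z z (K_fun k z).
Proof. by move=> f; rewrite act_autE bp_proj_twist. Qed.

Lemma star_surj (k : K_group e x) : exists phi : hom_kernel bar_morph, star phi = k.
Proof.
have tk : hom_kernel_set bar_morph (twist_aut k).
  apply: homeoP => y; rewrite -[LHS]/(phi_bar (twist_aut k) y).
  have [[i ->]|[z ->]] := punctured_cases x y; first by rewrite phi_bar_x.
  by rewrite phi_bar_val (phi_circE (twist_carries k z)).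
exists (SigSub (mem_set tk)); apply: val_inj; apply/funext => z.
exact: (phi_atE (twist_carries k z)).
Qed.

End Automorphisms.

Theorem theorem3p6 (S : signature) (A : algebra S) (n : nat) (e : 'I_n -> A)
    (d : Order.disp_t) (B : ctbDistrLatticeType d) (x : 'I_n -> stone B)
    (A_finite : finite_set [set: A])
    (A_simple : simple_algebra A)
    (A_malcev : malcev A)
    (A_nonabelian : ~ abelian_algebra A)
    (e_idem : forall i, idempotent_element (e i))
    (e_orbits : forall i j, i <> j -> ~ exists alpha : aut_group A, alpha (e i) = e j)
    (x_inj : injective x) :
  let D := filtered_boolean_power x e_idem in
  (* the definitions of phi_circ and phi_star are meaningful *)
  [/\ forall (phi : aut_group D) (z : punctured x), exists! w : punctured x,
        image_rel phi (theta (\val z)) = theta (\val w),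
      forall (phi : aut_group D) (z : punctured x), exists! alpha : aut_group A,
        forall f : D,
          alpha (bp_proj (\val z) f) = bp_proj (\val (phi_circ phi z)) (phi f) &
  exists h : {multiplicative aut_group D -> homeo_group x},
  [/\ (* (1) *)
      forall (phi : aut_group D) (y : stone B), (h phi : homeo_group x) y = phi_bar phi y,
      forall g : homeo_group x, exists phi : aut_group D, h phi = g,
      exists (act : group_action (homeo_group x) (hom_kernel h))
             (F : {multiplicative aut_group D -> semidirect act}), bijective F &
      (* (2) *)
      exists p : {multiplicative hom_kernel h -> K_group e x},
        (forall phi : hom_kernel h, \val (p phi) = phi_star (\val phi)) /\
        bijective p]].
Proof.
move=> D.
have carried (phi : aut_group D) (z : punctured x) :
    carries phi z (phi_circ phi z) (phi_at phi z) by apply: phi_carries.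
split=> [phi z|phi z|].
- exists (phi_circ phi z); split=> [|w]; rewrite (carries_theta (carried phi z)) //.
  exact: theta_inj.
- exists (phi_at phi z); split=> [|alpha alphaP]; first exact: carried.
  exact: phi_atE alphaP.
exists (bar_morph A_simple A_malcev A_nonabelian e_idem e_orbits x_inj); split=> [//|g||].
- by exists (homeo_aut x e_idem g); apply: bar_homeo_aut.
- have sK : cancel (homeo_aut x e_idem)
      (bar_morph A_simple A_malcev A_nonabelian e_idem e_orbits x_inj).
    exact: bar_homeo_aut.
  have split_h := split_semidirect sK; exact: split_h.
exists (star_morph A_finite A_simple A_malcev A_nonabelian e_idem e_orbits x_inj).
split=> //; apply: inj_surj_bijective; first exact: star_inj.
exact: star_surj.
Qed.
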